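(* Let $O,P\in\mathbb{Z}^2$ be integer points of the plane and let $\delta>0$ be a positive integer which is not a perfect square. The set of points $Q\in(\mathbb{Z}[\sqrt{\delta}])^2$ such that both Euclidean distances $d(O,Q)$ and $d(P,Q)$ belong to the ring $\mathbb{Z}[\sqrt{\delta}]$ is Zariski-dense in the plane.
   Context: $\mathbb{Z}[\sqrt{\delta}]$ is viewed as a subring of $\mathbb{R}$; $d$ is the Euclidean distance. *)

(* Defs.v *)
From mathcomp Require Import all_boot all_order all_algebra.
From mathcomp Require Import classical_sets reals mpoly.

Set Implicit Arguments.
Unset Strict Implicit.
Unset Printing Implicit Defensive.

Import GRing.Theory Num.Theory.
Local Open Scope classical_set_scope.
Local Open Scope ring_scope.

Section Plane.
Variable R : realType.

Definition Zsqrt (delta : nat) : set R :=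
  [set x | exists a b : int, x = a%:~R + b%:~R * Num.sqrt delta%:R].

(* The norm that MathComp-Analysis puts on 'rV[R]_n is the sup norm, so the
   Euclidean distance has to be spelled out. *)
Definition edist n (p q : 'rV[R]_n) : R :=
  Num.sqrt (\sum_(i < n) (p ord0 i - q ord0 i) ^+ 2).

Definition int_point n (p : 'rV[int]_n) : 'rV[R]_n := map_mx intr p.

Definition zero_locus n (I : set {mpoly R[n]}) : set 'rV[R]_n :=
  [set x | forall f : {mpoly R[n]}, I f -> f.@[fun i => x ord0 i] = 0].

Definition zariski_closed n (C : set 'rV[R]_n) : Prop :=
  exists I : set {mpoly R[n]}, C = zero_locus I.

Definition zariski_closure n (S : set 'rV[R]_n) : set 'rV[R]_n :=
  \bigcap_(C in [set C | zariski_closed C /\ S `<=` C]) C.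

Definition zariski_dense n (S : set 'rV[R]_n) : Prop :=
  zariski_closure S = setT.

End Plane.

(* Main.v *)
(** Put P - O = (a, b) and s = sqrt delta.  If x^2 = 1 + delta y^2, the vector
    (y s, 1) has integral length x, so every point Q = P + t (y s, 1) with t in
    Z[s] is at distance |t| x from P.  Put N = b y s - a, which is nonzero as s
    is irrational, and t = - b - N j s with j an integer; then
    Q - O = - N (1 + delta y j, j s), so |OQ| is |N| times the square root of
    (1 + delta y j)^2 + delta j^2.  The powers of a Pell unit make the latter a
    square for infinitely many j, and provide infinitely many y.  A polynomial
    vanishing at infinitely many points of each of infinitely many lines through
    P is zero.  When O = P, any other integer point may be used instead of P.

    Pell's equation is solved by walking along the river of Conway's topograph:
    the forms a u^2 + 2 h u v - b v^2 with a, b > 0 and h^2 + a b = delta are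
    finitely many, the walk permutes them, so it returns to u^2 - delta v^2 and
    the accumulated change of basis is an automorph of that form. *)
Require Import Defs.
From mathcomp Require Import all_boot all_order all_algebra.
From mathcomp Require Import boolp classical_sets reals mpoly.
From mathcomp Require Import zify ring.

Set Implicit Arguments.
Unset Strict Implicit.
Unset Printing Implicit Defensive.

Import Order.TTheory GRing.Theory Num.Theory.
Local Open Scope classical_set_scope.
Local Open Scope ring_scope.

(** * Pell's equation by the river walk *)

Lemma nonsquare_int (delta : nat) (z : int) :
  (~ exists m : nat, delta = (m ^ 2)%N) -> delta%:Z <> z ^+ 2.
Proof.
move=> nsq dE; apply: nsq; exists `|z|%N.
by apply/eqP; rewrite -eqz_nat PoszM abszE; apply/eqP; rewrite dE; nia.
Qed.

(** If [y] is nonzero, y^2 divides x^2, so [y] divides [x] and [delta] is the square of the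
    quotient. *)
Lemma mul_square_nonsquare (delta : nat) (x y : int) :
  (~ exists m : nat, delta = (m ^ 2)%N) ->
  delta%:Z * y ^+ 2 = x ^+ 2 -> x = 0 /\ y = 0.
Proof.
move=> nsq E; have [y0|y0] := eqVneq y 0.
  by split=> //; apply/eqP; rewrite -sqrf_eq0 -E y0 expr0n mulr0.
exfalso; have Ey : (`|x| ^ 2 = delta * `|y| ^ 2)%N by nia.
have : (`|y| ^ 2 %| `|x| ^ 2)%N by rewrite Ey dvdn_mull.
rewrite dvdn_pexp2r // => /dvdnP[k kE].
apply: nsq; exists k; move: Ey; rewrite kE expnMn => /eqP.
by rewrite eqn_pmul2r ?expn_gt0 ?absz_gt0 ?y0 // => /eqP.
Qed.

(* The sign of the value a + 2h - b of the form at (1, 1) decides which of the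
   two basis vectors (1, 0) and (0, 1) is replaced by (1, 1). *)
Definition river_step (v : int * int * int) : int * int * int :=
  let: (a, h, b) := v in
  if 0 < a + h *+ 2 - b then (a + h *+ 2 - b, h - b, b)
  else (a, h + a, b - a - h *+ 2).

Definition river (delta : nat) (v : int * int * int) : Prop :=
  let: (a, h, b) := v in [/\ 0 < a, 0 < b & h ^+ 2 + a * b = delta%:Z].

Lemma river_stepP (delta : nat) (v : int * int * int) :
  (~ exists m : nat, delta = (m ^ 2)%N) ->
  river delta v -> river delta (river_step v).
Proof.
move: v => [[a h] b] nsq [a0 b0 E] /=; case: ifP => n0; split=> //.
- by rewrite -E; ring.
(* A zero value at (1, 1) would make [delta] equal to (h + a)^2. *)
- have := nonsquare_int (z := h + a) nsq; rewrite -E => nE.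
  have : a + h *+ 2 - b != 0.
    apply/eqP => n1; apply: nE; have -> : b = a + h *+ 2 by lia.
    by ring.
  by lia.
- by rewrite -E; ring.
Qed.

(** The new form takes at (1, -1) the old value [a] in the first case and minus the old [b] in the
    second, so the sign there reveals the case. *)
Lemma river_step_inj (delta : nat) (v w : int * int * int) :
  river delta v -> river delta w -> river_step v = river_step w -> v = w.
Proof.
move: v w => [[a h] b] [[a' h'] b'] [a0 b0 _] [a0' b0' _] /=.
by case: ifP => n0; case: ifP => n0' [] *; congr (_, _, _); lia.
Qed.

Lemma nat_fin_collision (T : finType) (c : nat -> T) :
  exists i j : nat, (i < j)%N /\ c i = c j.
Proof.
pose f (i : 'I_#|T|.+1) := c i.
have /injectiveP/injectivePn[i [j ij fij]] : ~ injective f.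
  by move=> /leq_card; rewrite card_ord ltnn.
case: (ltngtP i j) => [lt|lt|eq]; last by rewrite (val_inj eq) eqxx in ij.
- by exists i, j.
- by exists j, i.
Qed.

Lemma river_periodic (delta : nat) (v : int * int * int) :
  (~ exists m : nat, delta = (m ^ 2)%N) -> river delta v ->
  exists2 n : nat, (0 < n)%N & iter n river_step v = v.
Proof.
move=> nsq v0; pose st n := iter n river_step v.
have stP n : river delta (st n) by elim: n => // n IH; apply: river_stepP.
(* As h^2 + a b = delta with a, b > 0, all entries are at most [delta] in absolute value; only [h]
   needs its sign recorded. *)
pose code (w : int * int * int) :=
  (inord `|w.1.1| : 'I_delta.+1, inord `|w.1.2| : 'I_delta.+1,
   inord `|w.2| : 'I_delta.+1, 0 <= w.1.2).
have code_inj w w' : river delta w -> river delta w' -> code w = code w' -> w = w'.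
  move: w w' => [[a h] b] [[a' h'] b'] [a0 b0 E] [a0' b0' E'] [].
  move=> /(congr1 val) /= ea /(congr1 val) /= eh /(congr1 val) /= eb es.
  by rewrite !inordK in ea eh eb; try nia; congr (_, _, _); lia.
have [i [j [ij /code_inj]]] := nat_fin_collision (code \o st).
move=> /(_ (stP i) (stP j)) E; exists (j - i)%N; first by rewrite subn_gt0.
(* Injectivity of the step carries the collision back to time 0. *)
elim: i j ij E => [|i IH] [|j] // ij E.
by rewrite subSS; apply: IH => //; apply: river_step_inj E.
Qed.

Definition pell (delta : nat) : set int :=
  [set y | 0 < y /\ exists2 x : int, 0 <= x & x ^+ 2 = 1 + delta%:Z * y ^+ 2].

Lemma pell_nonempty (delta : nat) :
  (0 < delta)%N -> (~ exists m : nat, delta = (m ^ 2)%N) ->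
  exists y, pell delta y.
Proof.
move=> d0 nsq.
have r0 : river delta (1, 0, delta%:Z) by split; lia.
have [n n0 nE] := river_periodic nsq r0.
(* (p, r) and (q, s) are the current basis vectors in the original coordinates. *)
have [] : exists p q r s : int, [/\ 0 <= p, 0 <= q, 0 <= r & 0 <= s] /\
  [/\ p * s - q * r = 1, n%:Z + 2 <= p + q + r + s &
   iter n river_step (1, 0, delta%:Z) =
    (p ^+ 2 - delta%:Z * r ^+ 2, p * q - delta%:Z * r * s,
     delta%:Z * s ^+ 2 - q ^+ 2)].
  elim: n {n0 nE} => [|n [p [q [r [s [[p0 q0 r0' s0] [det le E]]]]]]].
    exists 1, 0, 0, 1; split; split=> //=.
    by congr (_, _, _); ring.
  rewrite iterS E /=; case: ifP => _.
    exists (p + q), q, (r + s), s; split; split; try lia.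
    - have : q + s != 0.
        apply/eqP => qs; have [qz sz] : q = 0 /\ s = 0 by lia.
        by rewrite qz sz mulr0 mul0r in det.
      by lia.
    - by congr (_, _, _); ring.
  exists p, (p + q), r, (r + s); split; split; try lia.
  - have : p + r != 0.
      apply/eqP => pr; have [pz rz] : p = 0 /\ r = 0 by lia.
      by rewrite pz rz mulr0 mul0r in det.
    by lia.
  - by congr (_, _, _); ring.
move=> p [q [r [s [[p0 q0 r0' s0] [det le]]]]].
rewrite nE => -[Ea Eh Eb]; exists r; split; last by exists p => //; lia.
(* If [r] were 0, the change of basis would be the identity, whose entry sum 2 is less than n +
   2. *)
rewrite lt_neqAle r0' andbT; apply/eqP => r00.
subst r; nia.
Qed.

(** * Infinitely many solutions of Pell's equation and of the conic *)

Lemma unbounded_injseq (A : set int) :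
  (exists x, A x) -> (forall x, A x -> exists2 y, x < y & A y) ->
  exists2 f : nat -> int, injective f & forall n, A (f n).
Proof.
move=> [x0 Ax0] step.
have /choice[g gP] x : exists y, A x -> x < y /\ A y.
  have [/step[y xy Ay]|nA] := pselect (A x); last by exists x.
  by exists y.
pose f n := iter n g x0.
have Af n : A (f n) by elim: n => // n /gP[].
have fmono : {mono f : m n / (m <= n)%N >-> m <= n}.
  by apply: le_mono; apply: homo_ltn => [? ? ?|n]; [exact: lt_trans|]; have [] := gP _ (Af n).
by exists f => //; apply: inc_inj.
Qed.

(** The unit x + y sqrt delta is squared. *)
Lemma pell_unbounded (delta : nat) (y : int) :
  (0 < delta)%N -> pell delta y -> exists2 y', y < y' & pell delta y'.
Proof.
move=> d0 [y0 [x x0 E]]; have x1 : 0 < x by nia.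
exists (2 * x * y); first by nia.
split; first by rewrite !mulr_gt0.
exists (x ^+ 2 + delta%:Z * y ^+ 2); first by nia.
have -> : (2 * x * y) ^+ 2 = 4 * x ^+ 2 * y ^+ 2 by ring.
by rewrite E; ring.
Qed.

(** Here [h] will be |OQ| / |N|. Multiplying the equation by x^2 = 1 + delta y^2 turns it into a
    Pell equation. *)
Definition conic (delta : nat) (y : int) : set int :=
  [set j | 0 <= j /\ exists2 h : int,
     0 < h & h ^+ 2 = (1 + delta%:Z * y * j) ^+ 2 + delta%:Z * j ^+ 2].

(* The map sending j to j' is the action of (x + y sqrt delta)^4 on the solutions
   (x h, y + x^2 j) of Pell's equation; this fourth power is congruent to 1
   modulo x, with rational part congruent to 1 modulo x^2. *)
Lemma conic_unbounded (delta : nat) (x y j : int) :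
  (0 < delta)%N -> 0 < y -> x ^+ 2 = 1 + delta%:Z * y ^+ 2 ->
  conic delta y j -> exists2 j', j < j' & conic delta y j'.
Proof.
move=> d0 y0 E [j0 [h h0 Eh]].
pose d := delta%:Z; pose z := 1 + d * y ^+ 2.
(* With z = x^2, (x + y sqrt delta)^4 = (1 + z A) + x B sqrt delta. *)
pose A := 8 * d * y ^+ 2; pose B := 4 * y * (2 * z - 1).
have d_ge0 : 0 <= d by [].
have z0 : 0 < z by rewrite ltr_pwDl // !mulr_ge0 // ltW.
have A0 : 0 <= A by rewrite !mulr_ge0 // ltW.
have B0 : 0 < B.
  by rewrite !mulr_gt0 // subr_gt0; move: z0; clear; lia.
have yj : 0 <= y + z * j by rewrite addr_ge0 ?mulr_ge0 ?(ltW y0) ?(ltW z0).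
have zA : 0 < 1 + z * A by rewrite ltr_pwDl // mulr_ge0 // ltW.
have j_lt : j < h * B + y * A + j * (1 + z * A).
  rewrite mulrDr mulr1 addrCA ltrDl.
  by rewrite !ltr_pwDl ?(mulr_gt0 h0 B0) // !mulr_ge0 // ltW.
exists (h * B + y * A + j * (1 + z * A)) => //.
split; first exact: le_trans j0 (ltW j_lt).
exists (h * (1 + z * A) + d * (y + z * j) * B).
  by rewrite ltr_pwDl ?(mulr_gt0 h0 zA) // (mulr_ge0 _ (ltW B0)) ?mulr_ge0.
apply/eqP; rewrite -subr_eq0; apply/eqP.
(* The last factor is the norm of the fourth power, namely 1. *)
transitivity ((h ^+ 2 - ((1 + d * y * j) ^+ 2 + d * j ^+ 2)) *
   ((1 + z * A) ^+ 2 - d * z * B ^+ 2)); last by rewrite Eh subrr mul0r.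
by rewrite /B /A /z /d; ring.
Qed.

(** * Zariski density from a pencil of lines *)

Section Density.
Variable R : realType.

Lemma poly_injseq_eq0 (p : {poly R}) (u : nat -> R) :
  injective u -> (forall n, root p (u n)) -> p = 0.
Proof.
move=> ui pu; apply/eqP/negPn/negP => p0.
have rp : all (root p) (map u (iota 0 (size p))) by apply/allP => _ /mapP[n _ ->].
have up : uniq (map u (iota 0 (size p))) by rewrite map_inj_uniq ?iota_uniq.
by have := max_poly_roots p0 rp up; rewrite size_map size_iota ltnn.
Qed.

Lemma meval_horner n (f : {mpoly R[n]}) (q : 'I_n -> {poly R}) :
  exists g : {poly R}, forall t, g.[t] = f.@[fun i => (q i).[t]].
Proof.
exists (\sum_(m <- msupp f) (f@_m)%:P * \prod_i q i ^+ m i) => t.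
rewrite mevalE horner_sum; apply: eq_bigr => m _.
rewrite hornerM hornerC horner_prod; congr (_ * _).
by apply: eq_bigr => i _; rewrite horner_exp.
Qed.

(** Along a polynomial curve [f] becomes a univariate polynomial, and infinitely many roots make it
    zero. *)
Lemma meval_horner_eq0 n (f : {mpoly R[n]}) (q : 'I_n -> {poly R}) (u : nat -> R) :
  injective u -> (forall k, f.@[fun i => (q i).[u k]] = 0) ->
  forall t, f.@[fun i => (q i).[t]] = 0.
Proof.
have [g gE] := meval_horner f q => ui fu t; rewrite -gE.
by rewrite (@poly_injseq_eq0 g u) ?horner0 // => k; rewrite /root gE fu.
Qed.

Lemma zariski_dense_meval n (S : set 'rV[R]_n) :
  (forall f : {mpoly R[n]}, (forall x, S x -> f.@[fun i => x ord0 i] = 0) ->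
     forall x : 'rV[R]_n, f.@[fun i => x ord0 i] = 0) ->
  zariski_dense S.
Proof.
move=> H; apply/seteqP; split=> // x _ C [[I ->] SC] f If.
by apply: H => y /SC; apply.
Qed.

Lemma zariski_denseS n (S T : set 'rV[R]_n) :
  S `<=` T -> zariski_dense S -> zariski_dense T.
Proof.
move=> ST dS; apply/seteqP; split=> // x _ C [cC TC].
have : zariski_closure S x by rewrite dS.
by apply; split=> // y /ST /TC.
Qed.

Definition line_point (c : 'rV[R]_2) (m t : R) : 'rV[R]_2 :=
  \row_i (c ord0 i + t * (if i == ord0 then m else 1)).

Lemma zariski_dense_pencil (S : set 'rV[R]_2) (c : 'rV[R]_2) (m : nat -> R) :
  injective m ->
  (forall k, exists2 t : nat -> R, injective t &
     forall l, S (line_point c (m k) (t l))) ->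
  zariski_dense S.
Proof.
move=> mi St; apply: zariski_dense_meval => f fS x.
have ext (v w : 'I_2 -> R) : v =1 w -> f.@[v] = f.@[w] by apply: meval_eq.
have line k t : f.@[fun i => line_point c (m k) t ord0 i] = 0.
  have [u ui uS] := St k.
  pose q i : {poly R} := (c ord0 i)%:P + (if i == ord0 then m k else 1) *: 'X.
  have qE s i : (q i).[s] = line_point c (m k) s ord0 i.
    by rewrite mxE !hornerE mulrC.
  rewrite -(ext _ _ (qE t)); apply: (meval_horner_eq0 ui) => l.
  by rewrite (ext _ _ (qE (u l))); apply: fS.
(* For fixed [t], the points with varying slope parameter lie on a horizontal line. *)
have off t m' : f.@[fun i => line_point c m' t ord0 i] = 0.
  pose q (i : 'I_2) : {poly R} := (c ord0 i)%:P + t *: (if i == ord0 then 'X else 1).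
  have qE s i : (q i).[s] = line_point c s t ord0 i.
    by rewrite mxE !hornerE; case: ifP; rewrite !hornerE.
  rewrite -(ext _ _ (qE m')); apply: (meval_horner_eq0 mi) => l.
  by rewrite (ext _ _ (qE (m l))).
(* [off] misses the horizontal line through [c], so the vertical line through [x] is used, at
   heights k + 1 above [c] to keep the divisor nonzero. *)
pose q (i : 'I_2) : {poly R} := if i == ord0 then (x ord0 i)%:P else 'X.
have xE i : (q i).[x ord0 1] = x ord0 i.
  rewrite /q; case: eqP => [_|/eqP i0]; rewrite !hornerE //.
  by congr (x _ _); apply/val_inj; move: i i0 => [[|[]]].
rewrite -(ext _ _ xE).
apply: (@meval_horner_eq0 _ f q (fun k => c ord0 1 + k.+1%:R)).
  by move=> k l /addrI /eqP; rewrite eqr_nat => /eqP [].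
move=> k; rewrite -[RHS](off k.+1%:R ((x ord0 0 - c ord0 0) / k.+1%:R)).
apply: ext => i; rewrite mxE /q.
have k0 : k.+1%:R != 0 :> R by rewrite pnatr_eq0.
case: eqP => [->|/eqP i0].
  by rewrite hornerC mulrCA divff // mulr1 addrC subrK.
rewrite hornerX mulr1; by congr (c _ _ + _); apply/val_inj; move: i i0 => [[|[]]].
Qed.

End Density.

(** * Distances in Z[sqrt delta] and the points on the pencil *)

Lemma Zsqrt_norm (R : realType) (delta : nat) (x : R) :
  Zsqrt delta x -> Zsqrt delta `|x|.
Proof.
move=> [a [b ->]]; case: ger0P => _.
  by exists a, b.
by exists (- a), (- b); rewrite !rmorphN mulNr opprD.
Qed.

Lemma Zsqrt_edist (R : realType) (delta : nat) (p q : 'rV[R]_2) (u : R) :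
  Zsqrt delta u ->
  (p ord0 0 - q ord0 0) ^+ 2 + (p ord0 1 - q ord0 1) ^+ 2 = u ^+ 2 ->
  Zsqrt delta (edist p q).
Proof.
move=> Zu E; rewrite /edist big_ord_recl big_ord1.
have -> : lift ord0 ord0 = 1 :> 'I_2 by apply/val_inj.
by rewrite E sqrtr_sqr; apply: Zsqrt_norm.
Qed.

Lemma int_sqrt_eq (R : realType) (delta : nat) (u v : int) :
  (~ exists m : nat, delta = (m ^ 2)%N) ->
  u%:~R * Num.sqrt delta%:R = v%:~R :> R -> u = 0 /\ v = 0.
Proof.
move=> nsq /(congr1 (fun r => r ^+ 2)).
rewrite exprMn sqr_sqrtr ?ler0n // => E.
have [] // : v = 0 /\ u = 0.
apply: (mul_square_nonsquare nsq); apply/(@intr_inj R).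
by rewrite rmorphM !rmorphXn /= -E mulrC.
Qed.

Lemma zariski_dense_two_points (R : realType) (O P : 'rV[int]_2) (delta : nat) :
  (0 < delta)%N -> (~ exists m : nat, delta = (m ^ 2)%N) -> O != P ->
  zariski_dense [set Q : 'rV[R]_2 |
    [/\ forall i : 'I_2, Zsqrt delta (Q ord0 i),
        Zsqrt delta (edist (int_point R O) Q)
      & Zsqrt delta (edist (int_point R P) Q)]].
Proof.
move=> d0 nsq OP.
pose s : R := Num.sqrt delta%:R.
have s2 : s ^+ 2 = delta%:~R by rewrite sqr_sqrtr ?ler0n.
have s0 : s != 0 by rewrite sqrtr_eq0 lern0 -lt0n.
have [a aE] : exists a, P ord0 0 = O ord0 0 + a by exists (P ord0 0 - O ord0 0); rewrite subrKC.
have [b bE] : exists b, P ord0 1 = O ord0 1 + b by exists (P ord0 1 - O ord0 1); rewrite subrKC.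
have [Y Yi YP] := unbounded_injseq (pell_nonempty d0 nsq) (fun y => pell_unbounded d0).
apply: (@zariski_dense_pencil _ _ (int_point R P) (fun k => (Y k)%:~R * s)).
  by move=> k l /(mulIf s0) /intr_inj /Yi.
move=> k; have [y0 [X X0 XE]] := YP k; set y := Y k in y0 XE *.
have j0 : exists j, conic delta y j.
  by exists 0; split=> //; exists 1; rewrite // mulr0 addr0 !expr0n mulr0 addr0.
have [j ji jP] := unbounded_injseq j0 (fun j => conic_unbounded d0 y0 XE).
pose N : R := b%:~R * y%:~R * s - a%:~R.
(* N = 0 would force a = b = 0, that is O = P. *)
have N0 : N != 0.
  apply: contra OP => /eqP; rewrite /N => /eqP.
  rewrite subr_eq0 -rmorphM /= => /eqP /(int_sqrt_eq nsq) [/eqP].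
  rewrite mulf_eq0 (gt_eqF y0) orbF => /eqP bz az; apply/eqP/rowP => i.
  have [->|i0] := eqVneq i 0; first by rewrite aE az addr0.
  have -> : i = 1 by apply/val_inj; move: i i0 => [[|[]]].
  by rewrite bE bz addr0.
exists (fun l => - b%:~R - N * (j l)%:~R * s).
  by move=> l l' /addrI /oppr_inj /(mulIf s0) /(mulfI N0) /intr_inj /ji.
move=> l; have [_ [h _ hE]] := jP l; set q := j l in hE *.
have XER : X%:~R ^+ 2 = 1 + s ^+ 2 * y%:~R ^+ 2 :> R.
  by rewrite s2 -rmorphXn XE !(rmorphXn, rmorphM, rmorphD, rmorph1).
have hER : h%:~R ^+ 2 = (1 + s ^+ 2 * y%:~R * q%:~R) ^+ 2 + s ^+ 2 * q%:~R ^+ 2 :> R.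
  by rewrite s2 -rmorphXn hE !(rmorphXn, rmorphM, rmorphD, rmorph1).
split.
(* As s^2 = delta, t = -(b + b y delta q) + a q s; the coefficients of the coordinates of Q and of t
   X follow. *)
- move=> i; rewrite !mxE -/s; case: ifP => _.
    exists (P ord0 i + a * q * y * delta%:Z), (- b * (1 + y * delta%:Z * q) * y).
    rewrite !(rmorphM, rmorphD, rmorphN, rmorph1) /= -s2 /N -/s; ring.
  exists (P ord0 i - b - b * y * delta%:Z * q), (a * q).
  rewrite !(rmorphM, rmorphD, rmorphN, rmorph1) /= -s2 /N -/s; ring.
- apply: (@Zsqrt_edist _ _ _ _ (N * h%:~R)).
    by exists (- a * h), (b * y * h); rewrite !(rmorphM, rmorphN) /= /N -/s; ring.
  rewrite exprMn hER !mxE /= aE bE !rmorphD /N; ring.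
- apply: (@Zsqrt_edist _ _ _ _ ((- b%:~R - N * q%:~R * s) * X%:~R)).
    exists (- b * X - b * y * delta%:Z * q * X), (a * q * X).
    by rewrite !(rmorphM, rmorphD, rmorphN) /= -s2 /N -/s; ring.
  rewrite exprMn XER !mxE /=; ring.
Qed.

Theorem theorem8p1 (R : realType) (O P : 'rV[int]_2) (delta : nat)
    (delta_gt0 : (0 < delta)%N)
    (delta_nonsquare : ~ exists m : nat, delta = (m ^ 2)%N) :
  zariski_dense [set Q : 'rV[R]_2 |
    [/\ forall i : 'I_2, Zsqrt delta (Q ord0 i),
        Zsqrt delta (edist (int_point R O) Q)
      & Zsqrt delta (edist (int_point R P) Q)]].
Proof.
have [<-|OP] := eqVneq O P; last exact: zariski_dense_two_points.
have OO1 : O != O + const_mx 1.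
  by apply/eqP => /rowP /(_ 0) /eqP; rewrite !mxE -subr_eq0 opprD addNKr.
apply: zariski_denseS (zariski_dense_two_points R delta_gt0 delta_nonsquare OO1).
by move=> Q [].
Qed.
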